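(* For a given constant $N \in \mathbb{N}$, for every $\epsilon \in (0,1)$, and for every $n \in \mathbb{N}$, there exists $\delta \in (0,\infty)$ satisfying the following property: let $X$ be an $N$-doubling, proper, geodesically complete $\mathrm{CAT}(0)$ space; if $\partial_{\mathrm{T}}X$ satisfies $d_{\mathrm{GH}}(\partial_{\mathrm{T}}X, \mathbb{S}^{n-1}) < \delta$, then $X$ is $(1+\epsilon)$-bi-Lipschitz homeomorphic to $\mathbb{R}^n$.
   Context: $\mathbb{N}$ is the set of positive integers. A metric space is proper if every closed bounded subset is compact. A geodesic metric space is geodesically complete if every geodesic can be extended to a local geodesic defined on $\mathbb{R}$. A metric space is $N$-doubling if every open ball of radius $r$ in it can be covered by at most $N$ open balls of radius $r/2$ (for every $r>0$). $d_{\mathrm{GH}}$ is the Gromov--Hausdorff distance between metric spaces, and $\mathbb{S}^{n-1}$ is the standard unit sphere with its angular (length) metric. Tits boundary: the ideal boundary $\partial_{\infty}X$ of a complete $\mathrm{CAT}(0)$ space $X$ is the set of classes of geodesic rays modulo being asymptotic (at bounded distance). For $p\in X$, $\xi\in\partial_\infty X$ there is a unique ray $p\xi$ from $p$ in the class $\xi$; $\angle_p(\xi,\eta)$ is the angle at $p$ between $p\xi$ and $p\eta$. The angle metric is $\angle(\xi,\eta) := \sup_{p\in X}\angle_p(\xi,\eta)$; the Tits metric $d_{\mathrm{T}}$ is the length metric induced from $\angle$ (possibly taking the value $\infty$). The Tits boundary $\partial_{\mathrm{T}}X$ is $\partial_\infty X$ with $d_{\mathrm{T}}$. For $c\ge 1$,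 a map $f\colon X\to Y$ of metric spaces is $c$-bi-Lipschitz if $d_Y(f(x_1),f(x_2)) \le c\, d_X(x_1,x_2)$ and $d_X(x_1,x_2) \le c\, d_Y(f(x_1),f(x_2))$ for all $x_1,x_2\in X$; $X$ is $c$-bi-Lipschitz homeomorphic to $Y$ if there is a $c$-bi-Lipschitz homeomorphism $X\to Y$. *)

(* Defs.v *)
From HB Require Import structures.
From mathcomp Require Import all_boot all_order all_algebra.
From mathcomp Require Import all_classical all_reals all_analysis.

Set Implicit Arguments.
Unset Strict Implicit.
Unset Printing Implicit Defensive.

Import Order.TTheory GRing.Theory Num.Theory.
Import numFieldNormedType.Exports.

Local Open Scope classical_set_scope.
Local Open Scope ring_scope.

(** * Euclidean spaces and spheres *)

Definition dotv (R : realType) n (u v : 'rV[R]_n) : R :=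
  \sum_(i < n) u ord0 i * v ord0 i.

(* The library's norm on ['rV[R]_n] is the sup norm, so the Euclidean distance
   is introduced separately. *)
Definition eucl_dist (R : realType) n (u v : 'rV[R]_n) : R :=
  Num.sqrt (dotv (u - v) (u - v)).

(** * Geodesics and curvature *)

Definition geodesic_on (R : realType) (X : metricType R) (A : set R)
    (c : R -> X) : Prop :=
  forall s t, A s -> A t -> mdist (c s) (c t) = `|s - t|.

Definition geodesic_from_to (R : realType) (X : metricType R) (p q : X)
    (c : R -> X) : Prop :=
  [/\ c 0 = p, c (mdist p q) = q & geodesic_on `[0, mdist p q] c].

Definition geodesic_space (R : realType) (X : metricType R) : Prop :=
  forall p q : X, exists c, geodesic_from_to p q c.

Definition local_geodesic (R : realType) (X : metricType R) (c : R -> X) :=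
  forall t, exists2 e, 0 < e & geodesic_on (ball t e) c.

Definition geodesically_complete (R : realType) (X : metricType R) : Prop :=
  forall (a b : R) (c : R -> X), a <= b -> geodesic_on `[a, b] c ->
    exists2 g : R -> X, local_geodesic g & forall t, a <= t <= b -> g t = c t.

(* The point of the Euclidean segment from [p] to [q], of length [l], that is
   at distance [s] from [p] (it is [p] when [l = 0]). *)
Definition comparison_point (R : realType) (p q : 'rV[R]_2) (l s : R) :
    'rV[R]_2 :=
  p + (s / l) *: (q - p).

(* [c12], [c13], [c23] are the sides of a geodesic triangle and [q1 q2 q3] is a
   comparison triangle. The inequality is stated for two points on the sides
   issuing from [p1]; relabelling the vertices gives every pair of sides, and
   for two points on the same side it is an equality. *)
Definition CAT0 (R : realType) (X : metricType R) : Prop :=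
  geodesic_space X /\
  forall (p1 p2 p3 : X) (c12 c13 c23 : R -> X) (q1 q2 q3 : 'rV[R]_2),
    geodesic_from_to p1 p2 c12 ->
    geodesic_from_to p1 p3 c13 ->
    geodesic_from_to p2 p3 c23 ->
    eucl_dist q1 q2 = mdist p1 p2 ->
    eucl_dist q1 q3 = mdist p1 p3 ->
    eucl_dist q2 q3 = mdist p2 p3 ->
    forall s t, 0 <= s <= mdist p1 p2 -> 0 <= t <= mdist p1 p3 ->
      mdist (c12 s) (c13 t) <=
        eucl_dist (comparison_point q1 q2 (mdist p1 p2) s)
                  (comparison_point q1 q3 (mdist p1 p3) t).

Definition proper_space (R : realType) (X : metricType R) : Prop :=
  forall A : set X, closed A -> (exists x r, A `<=` ball x r) -> compact A.

Definition doubling (R : realType) (N : nat) (X : metricType R) : Prop :=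
  forall (x : X) (r : R), 0 < r ->
    exists2 s : seq X, (size s <= N)%N &
      ball x r `<=` \bigcup_(y in [set` s]) ball y (r / 2).

(** * Length metrics *)

(* Distances are allowed to take the value [+oo]. *)
Definition is_metric (R : realType) (T : Type) (d : T -> T -> \bar R) : Prop :=
  [/\ forall x y, (0 <= d x y)%E,
      forall x y, d x y = 0%E <-> x = y,
      forall x y, d x y = d y x &
      forall x y z, (d x z <= d x y + d y z)%E].

Definition continuous_curve (R : realType) (T : Type) (d : T -> T -> \bar R)
    (g : R -> T) : Prop :=
  forall t, 0 <= t <= 1 -> forall e, 0 < e ->
    exists2 r, 0 < r & forall s, 0 <= s <= 1 -> `|s - t| < r ->
      (d (g s) (g t) < e%:E)%E.

(* Supremum over the subdivisions [0 < s_1 < ... < s_k = 1]. *)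
Definition curve_length (R : realType) (T : Type) (d : T -> T -> \bar R)
    (g : R -> T) : \bar R :=
  ereal_sup [set (let F n := g (nth 1%R (0%R :: s) n) in
                  \sum_(0 <= n < size s) d (F n) (F n.+1))%E
            | s in itv_partition (0 : R) 1].

Definition length_metric (R : realType) (T : Type) (d : T -> T -> \bar R)
    (x y : T) : \bar R :=
  ereal_inf [set curve_length d g
            | g in [set g | [/\ continuous_curve d g, g 0 = x & g 1 = y]]].

(* The sphere of dimension [n.-1]. *)
Definition sphere (R : realType) (n : nat) : Type :=
  {u : 'rV[R]_n | dotv u u = 1}.

(* The angle itself if [n >= 2]; for [n = 1] the two points of the sphere are
   at distance [+oo], like the two points of the Tits boundary of a line. *)
Definition sphere_dist (R : realType) (n : nat) :
    sphere R n -> sphere R n -> \bar R :=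
  length_metric (fun u v => (acos (dotv (sval u) (sval v)))%:E).

(** * The Tits boundary *)

(* Only the values of [c] on [0, +oo[ matter. *)
Definition geodesic_ray (R : realType) (X : metricType R) (c : R -> X) :=
  geodesic_on [set t | 0 <= t] c.

Definition asymptotic (R : realType) (X : metricType R) (c c' : R -> X) :=
  exists K : R, forall t, 0 <= t -> mdist (c t) (c' t) <= K.

Definition ideal_boundary (R : realType) (X : metricType R) : Type :=
  {xi : set (R -> X) | exists2 c, geodesic_ray c &
     xi = [set c' | geodesic_ray c' /\ asymptotic c c']}.

Definition ray_from_to (R : realType) (X : metricType R) (p : X)
    (xi : ideal_boundary X) (c : R -> X) : Prop :=
  c 0 = p /\ sval xi c.

Definition comparison_angle (R : realType) (X : metricType R) (p x y : X) : R :=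
  acos ((mdist p x ^+ 2 + mdist p y ^+ 2 - mdist x y ^+ 2)
        / (2 * mdist p x * mdist p y)).

(* Angle between two geodesics issuing from the same point [c 0 = c' 0]. *)
Definition geodesic_angle (R : realType) (X : metricType R) (c c' : R -> X) :
    \bar R :=
  limf_esup (fun st : R * R => (comparison_angle (c 0) (c st.1) (c' st.2))%:E)
    (filter_prod 0^'+ 0^'+).

(* Supremum over [p]; in a complete CAT(0) space, [c] and [c'] are determined
   by [p]. *)
Definition boundary_angle (R : realType) (X : metricType R)
    (xi eta : ideal_boundary X) : \bar R :=
  ereal_sup [set a | exists p c c', [/\ ray_from_to p xi c,
    ray_from_to p eta c' & a = geodesic_angle c c']].

Definition Tits_dist (R : realType) (X : metricType R) :
    ideal_boundary X -> ideal_boundary X -> \bar R :=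
  length_metric (@boundary_angle R X).

(** * The Gromov-Hausdorff distance *)

Definition nbhd_of (R : realType) (Z : Type) (d : Z -> Z -> \bar R) (A : set Z)
    (r : R) : set Z :=
  [set z | exists2 a, A a & (d a z < r%:E)%E].

Definition hausdorff_dist (R : realType) (Z : Type) (d : Z -> Z -> \bar R)
    (A B : set Z) : \bar R :=
  ereal_inf [set r%:E | r in
    [set r : R | [/\ 0 < r, A `<=` nbhd_of d B r & B `<=` nbhd_of d A r]]].

Definition isometric_embedding (R : realType) (T Z : Type)
    (dT : T -> T -> \bar R) (dZ : Z -> Z -> \bar R) (f : T -> Z) : Prop :=
  forall x y, dZ (f x) (f y) = dT x y.

Definition GH_dist (R : realType) (T1 T2 : Type) (d1 : T1 -> T1 -> \bar R)
    (d2 : T2 -> T2 -> \bar R) : \bar R :=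
  ereal_inf [set h | exists (Z : Type) (dZ : Z -> Z -> \bar R)
      (f1 : T1 -> Z) (f2 : T2 -> Z),
    [/\ is_metric dZ, isometric_embedding d1 dZ f1,
        isometric_embedding d2 dZ f2 &
        h = hausdorff_dist dZ (range f1) (range f2)]].

(** * Bi-Lipschitz maps *)

Definition bilipschitz (R : realType) (T1 T2 : Type) (d1 : T1 -> T1 -> R)
    (d2 : T2 -> T2 -> R) (c : R) (f : T1 -> T2) : Prop :=
  forall x y, d2 (f x) (f y) <= c * d1 x y /\ d1 x y <= c * d2 (f x) (f y).

Definition homeomorphism (T1 T2 : topologicalType) (f : T1 -> T2) : Prop :=
  continuous f /\
  exists g : T2 -> T1, [/\ continuous g, cancel f g & cancel g f].

Definition bilipschitz_homeomorphic_Rn (R : realType) (c : R)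
    (X : metricType R) (n : nat) : Prop :=
  exists2 f : X -> 'rV[R]_n, homeomorphism f &
    bilipschitz (@mdist R X) (@eucl_dist R n) c f.

(* Main.v *)
Require Import Defs.
From HB Require Import structures.
From mathcomp Require Import all_boot all_order all_algebra.
From mathcomp Require Import all_classical all_reals all_analysis.
From mathcomp Require Import ring lra.
Import Order.TTheory GRing.Theory Num.Theory.
Import numFieldNormedType.Exports.
Local Open Scope classical_set_scope.
Local Open Scope ring_scope.
Set Implicit Arguments.
Unset Strict Implicit.
Unset Printing Implicit Defensive.

(** The map to Euclidean space is the vector of (opposites of) the Busemann
    functions of boundary points corresponding to the standard basis vectors.
    It maps every ray almost to a straight ray, at almost unit speed, because
    the angles at all points of [X] are determined by the Tits boundary up to a
    small error:

    - The angle at [p] between two boundary points is at most their Tits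
      distance, hence at most the spherical distance of the corresponding unit
      vectors up to an error ([cprod_ge]).

    - Conversely, the initial segment of every ray from [p] extends backwards
      to a line ([line_extension]), one of whose ends makes the angle [pi] with
      the ray at [p].
      The previous point forces this end to be almost antipodal
      ([antipodal_sum]), and since the angles of any direction with the two
      directions of a line add up to at least [pi] ([cprod_opposite]), the
      upper bound for one of them is a lower bound for the other ([cprod_le]).

    - The Busemann function of a boundary point with unit vector [u] therefore
      has slope almost [- sdot u z] along every ray with unit vector [z]
      ([busemann_slope]).

    Any two points lie on a ray, so the map is bi-Lipschitz with constant close
    to [1]. Conversely rays of every direction start from every point, so that
    from each point of the image one can move almost exactly in any prescribed
    direction and for any prescribed length. By properness of [X] the image
    contains a point closest to a given [y], and moving from there towards [y]
    would bring it closer unless it is [y] ([bilipschitz_surj]).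

    Apart from the first step, angles enter only through the monotone comparison
    products [cprod], so that the estimates are inequalities between squares of
    distances. *)

(** * Euclidean vectors *)

Section Euclid.
Variables (R : realType) (n : nat).
Implicit Types u v w : 'rV[R]_n.

Lemma dotvC u v : dotv u v = dotv v u.
Proof. by apply: eq_bigr => i _; rewrite mulrC. Qed.

Lemma dotvDl u v w : dotv (u + v) w = dotv u w + dotv v w.
Proof. by rewrite /dotv -big_split; apply: eq_bigr => i _; rewrite !mxE mulrDl. Qed.

Lemma dotvZl a u v : dotv (a *: u) v = a * dotv u v.
Proof. by rewrite /dotv mulr_sumr; apply: eq_bigr => i _; rewrite !mxE mulrA. Qed.

Lemma dotvDr u v w : dotv u (v + w) = dotv u v + dotv u w.
Proof. by rewrite dotvC dotvDl !(dotvC u). Qed.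

Lemma dotvZr a u v : dotv u (a *: v) = a * dotv u v.
Proof. by rewrite dotvC dotvZl dotvC. Qed.

Lemma dotvNl u v : dotv (- u) v = - dotv u v.
Proof. by rewrite -scaleN1r dotvZl mulN1r. Qed.

Lemma dotvNr u v : dotv u (- v) = - dotv u v.
Proof. by rewrite dotvC dotvNl dotvC. Qed.

Definition dotvE := (dotvDl, dotvDr, dotvNl, dotvNr, dotvZl, dotvZr).

Lemma dotv_ge0 u : 0 <= dotv u u.
Proof. by apply: sumr_ge0 => i _; rewrite -expr2 sqr_ge0. Qed.

Lemma dotv_eq0 u : dotv u u = 0 -> u = 0.
Proof.
move=> u0; apply/rowP => i; rewrite mxE; apply/eqP.
have := u0; rewrite /dotv => /psumr_eq0P => /(_ _ i isT) h.
by rewrite -sqrf_eq0 expr2 h// => j _; rewrite -expr2 sqr_ge0.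
Qed.

Lemma dotv_sqr_le u v : dotv u v ^+ 2 <= dotv u u * dotv v v.
Proof.
have [v0|v0] := eqVneq (dotv v v) 0.
  have -> : v = 0 by exact: dotv_eq0.
  by rewrite -(scale0r 0) !dotvE !mul0r mulr0 expr0n.
have v_gt0 : 0 < dotv v v by rewrite lt_neqAle eq_sym v0 dotv_ge0.
have := dotv_ge0 (dotv v v *: u - dotv u v *: v).
rewrite !dotvE (dotvC v u) => h.
rewrite -subr_ge0 -(pmulr_rge0 _ v_gt0); apply: le_trans h _.
by rewrite le_eqVlt; apply/orP; left; apply/eqP; ring.
Qed.

Lemma eucl_dist_sqr u v : eucl_dist u v ^+ 2 = dotv (u - v) (u - v).
Proof. by rewrite sqr_sqrtr// dotv_ge0. Qed.

Lemma eucl_dist_ge0 u v : 0 <= eucl_dist u v.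
Proof. exact: sqrtr_ge0. Qed.

Lemma dotv_unit_itv u v : dotv u u = 1 -> dotv v v = 1 -> -1 <= dotv u v <= 1.
Proof.
move=> u1 v1; have := dotv_sqr_le u v; rewrite u1 v1 mulr1 => h.
by rewrite -ler_norml -ler_sqr ?nnegrE// (real_normK (num_real _)) expr1n.
Qed.

Lemma dotv_unit_eq1 u v : dotv u u = 1 -> dotv v v = 1 -> dotv u v = 1 -> u = v.
Proof.
move=> u1 v1 uv; apply/subr0_eq/dotv_eq0.
by rewrite !dotvE (dotvC v u) u1 v1 uv; ring.
Qed.

Lemma eucl_distD u v w : eucl_dist u w <= eucl_dist u v + eucl_dist v w.
Proof.
rewrite -ler_sqr ?nnegrE ?addr_ge0 ?eucl_dist_ge0// sqrrD !eucl_dist_sqr.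
have -> : u - w = (u - v) + (v - w) by rewrite addrA subrK.
have E (a b : 'rV[R]_n) :
  dotv (a + b) (a + b) = dotv a a + 2 * dotv a b + dotv b b.
  by rewrite !dotvE (dotvC b a); ring.
have /ler_normlW h : `|dotv (u - v) (v - w)| <= eucl_dist u v * eucl_dist v w.
  rewrite -ler_sqr ?nnegrE ?mulr_ge0 ?eucl_dist_ge0// (real_normK (num_real _)) exprMn.
  by rewrite !eucl_dist_sqr dotv_sqr_le.
rewrite E; lra.
Qed.

Lemma eucl_distC u v : eucl_dist u v = eucl_dist v u.
Proof. by rewrite /eucl_dist -opprB dotvNl dotvNr opprK. Qed.

Lemma eucl_dist_coord u v i : `|u ord0 i - v ord0 i| <= eucl_dist u v.
Proof.
rewrite -ler_sqr ?nnegrE ?eucl_dist_ge0// (real_normK (num_real _)) eucl_dist_sqr /dotv.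
rewrite (bigD1 i)//= !mxE expr2 lerDl sumr_ge0// => j _.
by rewrite -expr2 sqr_ge0.
Qed.

Lemma eucl_dist_le u v e : 0 <= e ->
  (forall i, `|u ord0 i - v ord0 i| <= e) ->
  eucl_dist u v <= e * Num.sqrt n%:R.
Proof.
move=> e0 h; rewrite -ler_sqr ?nnegrE ?mulr_ge0 ?eucl_dist_ge0 ?sqrtr_ge0//.
rewrite eucl_dist_sqr exprMn sqr_sqrtr// /dotv.
rewrite mulr_natr -[n in leRHS]card_ord -sumr_const.
apply: ler_sum => i _; rewrite !mxE -expr2 -(real_normK (num_real _)) ler_sqr ?nnegrE//.
Qed.

End Euclid.

(** * Comparison angles in CAT(0) spaces *)

Section Cat0.
Variables (R : realType) (X : metricType R).
Implicit Types (p q x y z : X) (c g : R -> X).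

(** By the law of cosines this is [|px| |py|] times the cosine of the comparison
    angle at [p], that is, the inner product of two sides of a comparison
    triangle. Unlike the angle it makes sense for degenerate triangles. *)
Definition cprod p x y : R :=
  (mdist p x ^+ 2 + mdist p y ^+ 2 - mdist x y ^+ 2) / 2.

Lemma cprod_norm p x y : `|cprod p x y| <= mdist p x * mdist p y.
Proof.
have := metric_triangle p x y; have := metric_triangle x p y.
have := metric_triangle p y x; have := mdist_ge0 p x; have := mdist_ge0 p y.
rewrite (metric_sym y x) (metric_sym x p) ler_norml /cprod.
move: (mdist p x) (mdist p y) (mdist x y) => a b d *; apply/andP; split; nra.
Qed.

Lemma comparison_triangle (a b d : R) :
  0 < a -> 0 <= b -> 0 <= d -> a <= b + d -> b <= a + d -> d <= a + b ->
  exists q1 q2 q3 : 'rV[R]_2,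
    [/\ eucl_dist q1 q2 = a, eucl_dist q1 q3 = b & eucl_dist q2 q3 = d].
Proof.
move=> a0 b0 d0 abd bad dab.
pose x := (a ^+ 2 + b ^+ 2 - d ^+ 2) / (2 * a).
have ax : 2 * a * x = a ^+ 2 + b ^+ 2 - d ^+ 2.
  by rewrite /x mulrC mulfVK// mulf_neq0// ?pnatr_eq0// gt_eqF.
have xb : x ^+ 2 <= b ^+ 2.
  have : `|2 * a * x| <= 2 * a * b.
    by rewrite ax ler_norml; apply/andP; split; nra.
  rewrite normrM (gtr0_norm (_ : 0 < 2 * a)) ?mulr_gt0// ler_pM2l ?mulr_gt0//.
  by rewrite -ler_sqr ?nnegrE// (real_normK (num_real _)).
pose y := Num.sqrt (b ^+ 2 - x ^+ 2).
have y2 : y ^+ 2 = b ^+ 2 - x ^+ 2 by rewrite sqr_sqrtr// subr_ge0.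
pose vec (s t : R) : 'rV[R]_2 := \row_i (if i == ord0 then s else t).
have vecE s t s' t' : eucl_dist (vec s t) (vec s' t') =
    Num.sqrt ((s - s') ^+ 2 + (t - t') ^+ 2).
  rewrite /eucl_dist /dotv big_ord_recl big_ord1 !mxE/=.
  by rewrite -!expr2.
(* [x] is forced by the law of cosines, [y] by the length [b] *)
exists (vec 0 0), (vec a 0), (vec x y); rewrite !vecE; split.
- by rewrite subrr expr0n addr0 sub0r sqrrN sqrtr_sqr gtr0_norm.
- by rewrite !sub0r !sqrrN y2 addrC subrK sqrtr_sqr ger0_norm.
- have -> : (a - x) ^+ 2 + (0 - y) ^+ 2 = d ^+ 2.
    by rewrite sub0r sqrrN y2 sqrrB; lra.
  by rewrite sqrtr_sqr ger0_norm.
Qed.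

Lemma geodesic_onS (A B : set R) c :
  geodesic_on B c -> A `<=` B -> geodesic_on A c.
Proof. by move=> h AB s t /AB sB /AB tB; exact: h. Qed.

Lemma geodesic_dist0 (T : R) c t :
  geodesic_on `[0, T] c -> 0 <= t <= T -> mdist (c 0) (c t) = t.
Proof.
move=> cT /andP[t0 tT]; rewrite cT/= ?in_itv/= ?lexx ?t0 ?(le_trans t0 tT)//.
by rewrite sub0r normrN ger0_norm.
Qed.

Hypothesis X0 : CAT0 X.

(** This is the CAT(0) inequality for the triangle with vertices [c 0], [c S]
    and [c' T], expanded by the law of cosines: comparison angles decrease when
    the triangle shrinks towards the vertex [c 0]. *)
Lemma cprod_mono c c' (S T s t : R) :
  geodesic_on `[0, S] c -> geodesic_on `[0, T] c' -> c 0 = c' 0 ->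
  0 < S -> 0 < T -> 0 <= s <= S -> 0 <= t <= T ->
  s * t * cprod (c 0) (c S) (c' T) <= S * T * cprod (c 0) (c s) (c' t).
Proof.
move=> cS cT cc' S0 T0 sS tT.
have [Xg X1] := X0.
have [c23 c23P] := Xg (c S) (c' T).
have dS : mdist (c 0) (c S) = S by rewrite (geodesic_dist0 cS)// ltW//=.
have dT : mdist (c 0) (c' T) = T by rewrite cc' (geodesic_dist0 cT)// ltW//=.
have ds : mdist (c 0) (c s) = s by rewrite (geodesic_dist0 cS).
have dt : mdist (c 0) (c' t) = t by rewrite cc' (geodesic_dist0 cT).
have := metric_triangle (c 0) (c S) (c' T).
have := metric_triangle (c 0) (c' T) (c S).
have := metric_triangle (c S) (c 0) (c' T).
rewrite (metric_sym (c' T)) (metric_sym (c S) (c 0)) dS dT => h1 h2 h3.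
have [q1 [q2 [q3 [e12 e13 e23]]]] :=
  comparison_triangle S0 (ltW T0) (mdist_ge0 (c S) (c' T)) h2 h3 h1.
have := X1 (c 0) (c S) (c' T) c c' c23 q1 q2 q3.
rewrite dS dT => /(_ _ _ c23P e12 e13 e23 s t sS tT) => H.
have {}H : mdist (c s) (c' t) <=
    eucl_dist (comparison_point q1 q2 S s) (comparison_point q1 q3 T t).
  by apply: H; split; rewrite // ?dS ?dT.
have e : eucl_dist (comparison_point q1 q2 S s) (comparison_point q1 q3 T t) ^+ 2
   = s ^+ 2 + t ^+ 2 - 2 * (s / S) * (t / T) * cprod (c 0) (c S) (c' T).
  rewrite eucl_dist_sqr /comparison_point.
  move: (congr1 (fun r : R => r ^+ 2) e12) (congr1 (fun r : R => r ^+ 2) e13)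
    (congr1 (fun r : R => r ^+ 2) e23); rewrite !eucl_dist_sqr.
  have -> : q1 + (s / S) *: (q2 - q1) - (q1 + (t / T) *: (q3 - q1)) =
     (s / S) *: (q2 - q1) - (t / T) *: (q3 - q1) by rewrite opprD addrACA subrr add0r.
  have -> : q2 - q3 = (q2 - q1) - (q3 - q1) by rewrite opprB addrA subrK.
  rewrite -(opprB q2 q1) -(opprB q3 q1).
  move: (q2 - q1) (q3 - q1) => a b; rewrite !dotvE (dotvC b a) !opprK.
  rewrite /cprod dS dT => -> -> E; rewrite -E; field.
  by rewrite !gt_eqF.
have {}H : mdist (c s) (c' t) ^+ 2 <=
   s ^+ 2 + t ^+ 2 - 2 * (s / S) * (t / T) * cprod (c 0) (c S) (c' T).
  by rewrite -e ler_sqr ?nnegrE ?mdist_ge0 ?eucl_dist_ge0.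
rewrite [in leRHS]/cprod ds dt.
have -> : s * t * cprod (c 0) (c S) (c' T) =
  S * T * ((s / S) * (t / T) * cprod (c 0) (c S) (c' T)).
  by field; rewrite !gt_eqF.
by rewrite ler_pM2l ?mulr_gt0//; lra.
Qed.

End Cat0.

(** * Geodesic lines *)

Section Lines.
Variables (R : realType) (X : metricType R).
Implicit Types (p q x y z : X) (c g : R -> X).
Hypothesis X0 : CAT0 X.

Lemma geodesic_on_shift (A : set R) c a :
  geodesic_on A c -> geodesic_on [set t | A (a + t)] (fun t => c (a + t)).
Proof. by move=> cA s t As At; rewrite cA// opprD addrACA subrr add0r. Qed.

Lemma geodesic_on_rev (A : set R) c a :
  geodesic_on A c -> geodesic_on [set t | A (a - t)] (fun t => c (a - t)).
Proof.
move=> cA s t As At; rewrite cA// distrC; congr `|_|; ring.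
Qed.

(** At the gluing parameter the comparison angle of two short segments is
    [pi]; by monotonicity it is [pi] for the long ones too. *)
Lemma geodesic_on_glue c (a m b e : R) :
  0 < e -> a <= m -> m <= b ->
  geodesic_on `[a, m] c -> geodesic_on `[m - e, b] c -> geodesic_on `[a, b] c.
Proof.
move=> e0 am mb cl cr.
suff H (x z : R) : a <= x <= m -> m <= z <= b -> mdist (c x) (c z) = z - x.
  move=> s t; rewrite /= !in_itv/= => /andP[a_s sb] /andP[a_t tb].
  have [sm|ms] := leP s m; have [tm|mt] := leP t m.
  - by rewrite cl//= in_itv/= ?a_s ?a_t.
  - have st : s <= t by rewrite (le_trans sm)// ltW.
    by rewrite H ?a_s ?(ltW mt)// distrC ger0_norm// subr_ge0.
  - have ts : t <= s by rewrite (le_trans tm)// ltW.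
    by rewrite metric_sym H ?a_t ?(ltW ms)// ger0_norm// subr_ge0.
  - by rewrite cr//= in_itv/= ?sb ?tb andbT; lra.
move=> /andP[ax]; rewrite le_eqVlt => /predU1P[-> /andP[mz zb]|xm].
  by rewrite cr/= ?in_itv/= 1?distrC ?ger0_norm ?subr_ge0 ?mz ?zb ?andbT//; lra.
move=> /andP[]; rewrite le_eqVlt => /predU1P[<- _|mz zb].
  rewrite cl/= ?in_itv/= 1?distrC ?ger0_norm ?subr_ge0 ?ax ?(ltW xm) ?lexx//.
  by rewrite ltW// (le_lt_trans ax).
pose S := m - x; pose T := z - m.
have S0 : 0 < S by rewrite subr_gt0.
have T0 : 0 < T by rewrite subr_gt0.
pose h := Num.min e (Num.min S T).
have h0 : 0 < h by rewrite !lt_min e0 S0 T0.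
have [he hS hT] : [/\ h <= e, h <= S & h <= T].
  by rewrite !ge_min !lexx !orbT.
have cS : geodesic_on `[0, S] (fun t => c (m - t)).
  refine (geodesic_onS (geodesic_on_rev (a := m) cl) _) => t /=.
  rewrite !in_itv/= /S; lra.
have cT : geodesic_on `[0, T] (fun t => c (m + t)).
  refine (geodesic_onS (geodesic_on_shift (a := m) cr) _) => t /=.
  rewrite !in_itv/= /T; lra.
have dSh : mdist (c (m - 0)) (c (m - h)) = h.
  by rewrite (geodesic_dist0 cS)// hS ltW.
have dTh : mdist (c (m + 0)) (c (m + h)) = h.
  by rewrite (geodesic_dist0 cT)// hT ltW.
have dS : mdist (c (m - 0)) (c (m - S)) = S.
  by rewrite (geodesic_dist0 cS)// lexx ltW.
have dT : mdist (c (m + 0)) (c (m + T)) = T.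
  by rewrite (geodesic_dist0 cT)// lexx ltW.
have dh : mdist (c (m - h)) (c (m + h)) = 2 * h.
  rewrite cr/= ?in_itv/=; last 2 first.
  - by apply/andP; split; lra.
  - by apply/andP; split; rewrite /T in hT; lra.
  by rewrite distrC ger0_norm; lra.
have hSS : 0 <= h <= S by rewrite hS ltW.
have hTT : 0 <= h <= T by rewrite hT ltW.
have := cprod_mono X0 cS cT _ S0 T0 hSS hTT; rewrite subr0 addr0 => /(_ erefl).
move: dS dT dSh dTh; rewrite subr0 addr0 => dS dT dSh dTh.
rewrite /cprod dS dT dSh dTh dh {dS dT dSh dTh}.
have -> : m - S = x by rewrite /S; ring.
have -> : m + T = z by rewrite /T; ring.
have -> : (h ^+ 2 + h ^+ 2 - (2 * h) ^+ 2) / 2 = - h ^+ 2 by field.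
rewrite (_ : S * T * - h ^+ 2 = h * h * (- (S * T))); last by ring.
rewrite ler_pM2l ?mulr_gt0// => ST.
have dge : S + T <= mdist (c x) (c z).
  have ST0 : 0 <= S + T by exact: addr_ge0 (ltW S0) (ltW T0).
  rewrite -ler_sqr ?nnegrE ?mdist_ge0 ?ST0//.
  by rewrite sqrrD; lra.
have dxm : mdist (c x) (c m) = S.
  by rewrite cl/= ?in_itv/= ?lexx ?ax ?am ?(ltW xm)// distrC gtr0_norm.
have dmz : mdist (c m) (c z) = T.
  have me : m - e <= m <= b by rewrite mb andbT; lra.
  have ze : m - e <= z <= b by rewrite zb andbT; lra.
  by rewrite cr/= ?in_itv// distrC gtr0_norm.
have := metric_triangle (c x) (c m) (c z); rewrite dxm dmz => dle.
by apply/eqP; rewrite eq_le; move: dge dle; rewrite /S /T; lra.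
Qed.

(** Otherwise the supremum of the [t] for which [g] is geodesic on [`[a, t]]
    could be increased by gluing. *)
Lemma local_geodesic_line g : local_geodesic g -> geodesic_on setT g.
Proof.
move=> gl.
suff H (a b : R) : a <= b -> geodesic_on `[a, b] g.
  move=> s t _ _; have [st|ts] := leP s t.
    by apply: (H s t st) => /=; rewrite in_itv/= ?lexx ?st.
  by apply: (H t s (ltW ts)) => /=; rewrite in_itv/= ?lexx ?(ltW ts).
move=> ab; pose E := [set t | a <= t /\ geodesic_on `[a, t] g].
have Ea : E a.
  split=> // s t; rewrite /= !in_itv/= -!eq_le => /eqP <- /eqP <-.
  by rewrite mdistxx subrr normr0.
have Edown t s : E t -> a <= s -> s <= t -> E s.
  move=> [at_ gt] a_s st; split=> //; refine (geodesic_onS gt _) => u /=.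
  by rewrite !in_itv/= => /andP[-> us]; exact: le_trans us st.
apply: contrapT => nEb.
have ubE : ubound E b.
  move=> t Et; rewrite leNgt; apply/negP => bt.
  by apply: nEb; have [] := Edown t b Et ab (ltW bt).
have supE : has_sup E by split; [exists a|exists b].
have [e e0 ge] := gl (sup E).
have [t Et st] := sup_adherent e0 supE.
have ts : t <= sup E by exact: (ub_le_sup (proj2 supE)) Et.
suff : E (sup E + e / 2).
  by move=> H; have := ub_le_sup (proj2 supE) H; rewrite gerDl leNgt divr_gt0.
have [at_ gt] := Et; split; first by rewrite (le_trans at_)//; lra.
apply: (@geodesic_on_glue _ a t _ ((t - (sup E - e)) / 2)) => //; [lra|lra|].
refine (geodesic_onS ge _) => u /=; rewrite in_itv/= => /andP[u1 u2].
by rewrite /ball/= ltr_norml; apply/andP; split; lra.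
Qed.

Lemma line_extension c (a b : R) : geodesically_complete X ->
  a <= b -> geodesic_on `[a, b] c ->
  exists2 g, geodesic_on setT g & forall t, a <= t <= b -> g t = c t.
Proof.
move=> Xc ab /(Xc a b c ab)[g gl gc].
by exists g => //; exact: local_geodesic_line.
Qed.

(** The point [g 0] is the midpoint of the side from [g (- s)] to [g s] of a
    triangle with third vertex [z]; monotonicity at the vertex [g (- s)] then
    gives the Bruhat-Tits inequality. In this form it says that the comparison
    angles of [z] with the two directions of a line add up to at least [pi]. *)
Lemma cprod_opposite g (s : R) z : geodesic_on setT g -> 0 <= s ->
  cprod (g 0) (g s) z + cprod (g 0) (g (- s)) z <= 0.
Proof.
move=> gT; rewrite le_eqVlt => /predU1P[<-|s0].
  by rewrite oppr0 /cprod mdistxx; lra.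
have [xz|xz] := eqVneq (g (- s)) z.
  have d0s : mdist (g 0) (g s) = s by rewrite gT// sub0r normrN gtr0_norm.
  have d0n : mdist (g 0) (g (- s)) = s by rewrite gT// sub0r opprK gtr0_norm.
  have ds : mdist (g s) (g (- s)) = 2 * s.
    by rewrite gT// opprK gtr0_norm; lra.
  by rewrite /cprod -xz d0s d0n ds mdistxx; nra.
have [c [c0 c1 cg]] : exists c, geodesic_from_to (g (- s)) z c.
  by have [+ _] := X0; exact.
pose T := mdist (g (- s)) z; have T0 : 0 < T by rewrite mdist_gt0.
have gS : geodesic_on `[0, 2 * s] (fun t => g (- s + t)).
  by refine (geodesic_onS (geodesic_on_shift (a := (- s)) gT) _) => t.
have hs : 0 <= s <= 2 * s by apply/andP; split; lra.
have hT : 0 <= T <= T by rewrite lexx ltW.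
have hs2 : 0 < 2 * s by lra.
have := cprod_mono X0 gS cg _ hs2 T0 hs hT; rewrite addr0 c0 => /(_ erefl).
rewrite c1 addNr (_ : - s + 2 * s = s); last by ring.
rewrite (_ : 2 * s * T * _ = s * T * (2 * cprod (g (- s)) (g 0) z)); last by ring.
rewrite ler_pM2l ?mulr_gt0//.
have d1 : mdist (g (- s)) (g s) = 2 * s.
  by rewrite gT// distrC opprK gtr0_norm; lra.
have d2 : mdist (g (- s)) (g 0) = s.
  by rewrite gT// distrC sub0r opprK gtr0_norm.
have d3 : mdist (g 0) (g s) = s by rewrite gT// distrC subr0 gtr0_norm.
rewrite /cprod (metric_sym (g 0) (g (- s))) d1 d2 d3; lra.
Qed.

End Lines.

(** * Rays from a given point *)

Section Rays.
Variables (R : realType) (X : metricType R).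
Implicit Types (p q x y z : X) (c g r : R -> X).

Lemma geodesic_rayS c (T : R) : geodesic_ray c -> geodesic_on `[0, T] c.
Proof. by move=> cr s t /andP[s0 _] /andP[t0 _]; exact: cr. Qed.

Lemma ray_dist0 c (t : R) : geodesic_ray c -> 0 <= t -> mdist (c 0) (c t) = t.
Proof.
by move=> cr t0; rewrite (geodesic_dist0 (geodesic_rayS (T := t) cr))// t0 lexx.
Qed.

Lemma mdist_le_eps_eq x y : (forall e : R, 0 < e -> mdist x y <= e) -> x = y.
Proof.
move=> h; apply: mdist_positivity; apply/eqP; rewrite eq_le mdist_ge0 andbT.
by apply/ler_addgt0Pl => e e0; rewrite addr0; exact: h.
Qed.

Lemma ray_dist_bounds p c (t : R) : geodesic_ray c -> 0 <= t ->
  t - mdist p (c 0) <= mdist p (c t) <= t + mdist p (c 0).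
Proof.
move=> cr t0; have d := ray_dist0 cr t0.
have := metric_triangle p (c 0) (c t); have := metric_triangle (c 0) p (c t).
by rewrite (metric_sym (c 0) p) d => *; apply/andP; split; lra.
Qed.

Hypothesis X0 : CAT0 X.

Lemma geodesic_thales c c' (S T l : R) :
  geodesic_on `[0, S] c -> geodesic_on `[0, T] c' -> c 0 = c' 0 ->
  0 < S -> 0 < T -> 0 <= l <= 1 ->
  mdist (c (l * S)) (c' (l * T)) <= l * mdist (c S) (c' T).
Proof.
move=> cS cT cc S0 T0 /andP[l0 l1].
have lS : 0 <= l * S <= S by rewrite mulr_ge0 ?(ltW S0)//= ger_pMl.
have lT : 0 <= l * T <= T by rewrite mulr_ge0 ?(ltW T0)//= ger_pMl.
have := cprod_mono X0 cS cT cc S0 T0 lS lT.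
rewrite (_ : l * S * (l * T) * _ = S * T * (l ^+ 2 * cprod (c 0) (c S) (c' T)));
  last by ring.
rewrite ler_pM2l ?mulr_gt0// /cprod.
have -> : mdist (c 0) (c (l * S)) = l * S by rewrite (geodesic_dist0 cS).
have -> : mdist (c 0) (c' (l * T)) = l * T by rewrite cc (geodesic_dist0 cT).
have -> : mdist (c 0) (c S) = S by rewrite (geodesic_dist0 cS)// lexx ltW.
have -> : mdist (c 0) (c' T) = T by rewrite cc (geodesic_dist0 cT)// lexx ltW.
move=> h; rewrite -ler_sqr ?nnegrE ?mulr_ge0 ?mdist_ge0// !exprMn.
move: h; rewrite !exprMn; lra.
Qed.

(** The segments from [p] to the points of a ray form a Cauchy family: they
    have the same length as the corresponding piece of the ray up to a bounded
    error, so that their comparison angle at [p] tends to [0]. *)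
Lemma ray_segments_cauchy p c f f' (a b s : R) :
  geodesic_ray c -> geodesic_from_to p (c a) f -> geodesic_from_to p (c b) f' ->
  0 <= s -> 2 * mdist p (c 0) + s < a -> a <= b ->
  mdist (f s) (f' s) ^+ 2 * (a - mdist p (c 0)) <= 8 * mdist p (c 0) * s ^+ 2.
Proof.
move=> cr [f0 f1 fg] [f'0 f'1 f'g] s0 sa ab.
have K0 := mdist_ge0 p (c 0).
have a0 : 0 <= a by lra.
have b0 : 0 <= b by lra.
have /andP[] := ray_dist_bounds p cr a0; have /andP[] := ray_dist_bounds p cr b0.
move: (mdist p (c 0)) K0 sa => K K0 sa.
have dab : mdist (c a) (c b) = b - a.
  by rewrite cr//= distrC ger0_norm ?subr_ge0.
have := metric_triangle p (c a) (c b); have := metric_triangle p (c b) (c a).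
rewrite (metric_sym (c b)) dab.
have ff : f 0 = f' 0 by rewrite f0 f'0.
have ds : forall h x, h 0 = p -> geodesic_on `[0, mdist p x] h -> s <= mdist p x ->
    mdist p (h s) = s.
  by move=> h x h0 hg sx; rewrite -{1}h0 (geodesic_dist0 hg) ?s0.
have := ds _ _ f'0 f'g; have := ds _ _ f0 fg.
have := fun u v => @cprod_mono _ _ X0 _ _ _ _ u v fg f'g ff.
rewrite f1 f'1 f0 /cprod dab.
move: (mdist p (c a)) (mdist p (c b)) => A B H d1 d2 h1 h2 b1 b2 a1 a2.
have A0 : 0 < A by lra.
have B0 : 0 < B by lra.
have {}d1 : mdist p (f s) = s by apply: d1; lra.
have {}d2 : mdist p (f' s) = s by apply: d2; lra.
have sA : 0 <= s <= A by rewrite s0; lra.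
have sB : 0 <= s <= B by rewrite s0; lra.
have {}H := H s s A0 B0 sA sB; rewrite d1 d2 in H.
move: (mdist (f s) (f' s)) H => d H.
have hd : A * B * d ^+ 2 <= s ^+ 2 * ((b - a) ^+ 2 - (B - A) ^+ 2) by lra.
have hK : (b - a) ^+ 2 - (B - A) ^+ 2 <= 8 * K * B.
  have -> : (b - a) ^+ 2 - (B - A) ^+ 2 = (b - a - B + A) * (b - a + B - A) by ring.
  apply: (@le_trans _ _ (2 * K * (4 * B))); last first.
    by rewrite le_eqVlt; apply/orP; left; apply/eqP; ring.
  by apply: ler_pM; lra.
have s20 : 0 <= s ^+ 2 by exact: sqr_ge0.
have {}hd : A * d ^+ 2 <= 8 * K * s ^+ 2.
  rewrite -(ler_pM2l B0); apply: (@le_trans _ _ (s ^+ 2 * (8 * K * B))); last first.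
    by rewrite le_eqVlt; apply/orP; left; apply/eqP; ring.
  apply: le_trans (ler_wpM2l s20 hK).
  by apply: le_trans hd; rewrite le_eqVlt; apply/orP; left; apply/eqP; ring.
apply: le_trans hd; rewrite mulrC; apply: ler_wpM2r; first exact: sqr_ge0.
lra.
Qed.

(** Seen from [c b], where both end, the segment and the ray diverge at most
    linearly, up to [mdist p (c 0)]; the other [mdist p (c 0)] pays for the
    difference of their lengths. *)
Lemma ray_segments_bounded p c f (b s : R) :
  geodesic_ray c -> geodesic_from_to p (c b) f ->
  0 <= s -> s + mdist p (c 0) < b ->
  mdist (c s) (f s) <= 2 * mdist p (c 0).
Proof.
move=> cr [f0 f1 fg] s0 sb.
have K0 := mdist_ge0 p (c 0).
have b0 : 0 < b by lra.
have /andP[D1 D2] := ray_dist_bounds p cr (ltW b0).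
set D := mdist p (c b) in D1 D2 f1 fg; set K := mdist p (c 0) in K0 sb D1 D2 *.
have D0 : 0 < D by lra.
have cS : geodesic_on `[0, b] (fun t => c (b - t)).
  refine (geodesic_onS (geodesic_on_rev (a := b) (geodesic_rayS (T := b) cr)) _) => t /=.
  rewrite !in_itv/=; lra.
have cT : geodesic_on `[0, D] (fun t => f (D - t)).
  refine (geodesic_onS (geodesic_on_rev (a := D) fg) _) => t /=; rewrite !in_itv/=; lra.
have cc : c (b - 0) = f (D - 0) by rewrite !subr0 f1.
pose l := (b - s) / b.
have l01 : 0 <= l <= 1.
  by rewrite /l ler_pdivlMr// ler_pdivrMr//; lra.
have := geodesic_thales cS cT cc b0 D0 l01.
rewrite !subrr f0 (metric_sym (c 0)) -/K.
have -> : b - l * b = s by rewrite /l; field; rewrite gt_eqF.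
have e : D - l * D = s * D / b by rewrite /l; field; rewrite gt_eqF.
have lK : l * K <= K by have /andP[_ l1] := l01; exact: ler_piMl.
have dl : mdist (f (D - l * D)) (f s) <= K.
  have i1 : 0 <= s * D / b <= D.
    rewrite divr_ge0 ?mulr_ge0 ?(ltW D0) ?(ltW b0)//= ler_pdivrMr// mulrC.
    by rewrite ler_pM2l//; lra.
  have i2 : 0 <= s <= D by rewrite s0 /=; lra.
  rewrite e fg/= ?in_itv//.
  have -> : s * D / b - s = (s / b) * (D - b) by field; rewrite gt_eqF.
  rewrite normrM ger0_norm ?divr_ge0 ?(ltW b0)//.
  apply: (@le_trans _ _ (1 * K)); last by rewrite mul1r.
  apply: ler_pM => //; first by rewrite divr_ge0 ?(ltW b0).
    by rewrite ler_pdivrMr//; lra.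
  by rewrite ler_norml; apply/andP; split; lra.
have := metric_triangle (c s) (f (D - l * D)) (f s).
lra.
Qed.

Lemma closed_mball p (s : R) : closed [set y | mdist p y <= s].
Proof.
move=> y /= yc; apply/ler_addgt0Pl => e e0.
have [z [/= pz yz]] := yc (ball y e) (nbhsx_ballx y e e0).
have := metric_triangle p z y; rewrite ballEmdist/= in yz.
by rewrite (metric_sym z y); lra.
Qed.

Hypothesis Xp : proper_space X.

Lemma compact_mball p (s : R) : compact [set y | mdist p y <= s].
Proof.
apply: Xp; first exact: closed_mball.
by exists p, (s + 1) => y /= ys; rewrite ballEmdist/=; lra.
Qed.

(** Properness turns the Cauchy family of the segments from [p] to the points
    [c n] into a ray. The segments are part of the conclusion because Busemann
    functions are defined by the points [c s], so that they are compared with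
    the new ray through these segments. *)
Lemma ray_from_point p c : geodesic_ray c ->
  exists (f : nat -> R -> X) (r : R -> X),
  [/\ forall n, geodesic_from_to p (c n%:R) (f n),
      geodesic_ray r, r 0 = p, asymptotic c r &
      forall s e, 0 <= s -> 0 < e -> \forall n \near \oo, mdist (f n s) (r s) <= e].
Proof.
move=> cr.
have /choice[f fP] : forall n : nat, exists g, geodesic_from_to p (c n%:R) g.
  by move=> n; have [+ _] := X0; exact.
pose K := mdist p (c 0).
have K0 : 0 <= K := mdist_ge0 _ _.
have fs (s : R) : 0 <= s -> \forall n \near \oo,
    geodesic_on `[0, s] (f n) /\ mdist (c s) (f n s) <= 2 * K.
  move=> s0; near=> n.
  have nK : s + K < n%:R by near: n; exact: nbhs_infty_gtr.
  have n0 : 0 <= n%:R :> R by exact: ler0n.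
  have [_ _ fg] := fP n; split; last exact: ray_segments_bounded (fP n) s0 nK.
  have /andP[h _] := ray_dist_bounds p cr n0.
  refine (geodesic_onS fg _) => t /=; rewrite !in_itv/= => /andP[-> ts] /=.
  by move: h; rewrite -/K; lra.
have cauchy (s e : R) : 0 <= s -> 0 < e -> \forall n \near \oo,
    forall m, (n <= m)%N -> mdist (f n s) (f m s) <= e.
  move=> s0 e0; near=> n => m nm.
  have n1 : 2 * K + s < n%:R by near: n; exact: nbhs_infty_gtr.
  have n2 : K + 8 * K * s ^+ 2 / e ^+ 2 < n%:R by near: n; exact: nbhs_infty_gtr.
  have nm' : n%:R <= m%:R :> R by rewrite ler_nat.
  have := ray_segments_cauchy cr (fP n) (fP m) s0 n1 nm'.
  rewrite -/K => h.
  have e20 : 0 < e ^+ 2 by rewrite exprn_gt0.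
  have nK : 0 < n%:R - K by lra.
  rewrite -ler_sqr ?nnegrE ?mdist_ge0 ?(ltW e0)// -(ler_pM2r nK).
  apply: (le_trans h).
  have : 8 * K * s ^+ 2 / e ^+ 2 <= n%:R - K by lra.
  by rewrite ler_pdivrMr// (mulrC (n%:R - K)) => /le_trans; apply; rewrite mulrC.
have /choice[r rP] : forall s : R, exists l, 0 <= s ->
    forall e, 0 < e -> \forall n \near \oo, mdist (f n s) l <= e.
  move=> s; have [s0|s0] := leP 0 s; last by exists p.
  have Ff : (f ^~ s @ \oo) [set y | mdist p y <= s].
    rewrite /fmap/=; have := fs s s0; apply: filterS => n [fg _] /=.
    have [<- _ _] := fP n; rewrite (geodesic_dist0 fg)//.
    by rewrite s0 lexx.
  have [l [_ lP]] := @compact_mball p s _ (fmap_proper_filter _ _) Ff.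
  exists l => _ e e0.
  have e20 : 0 < e / 2 by rewrite divr_gt0.
  have := cauchy s (e / 2) s0 e20; apply: filterS => n nP.
  have ge_n : (f ^~ s @ \oo) [set y | exists2 m, (n <= m)%N & y = f m s].
    by exists n => // m /= nm; exists m.
  have [y [[m nm ->]]] := lP _ _ ge_n (nbhsx_ballx l _ e20).
  rewrite ballEmdist/= => lm.
  have := metric_triangle (f n s) (f m s) l; rewrite (metric_sym (f m s) l).
  by have := nP m nm; lra.
exists f, r.
have r0 : r 0 = p.
  apply: mdist_le_eps_eq => e e0.
  have [n nP] := filter_ex (rP 0 (lexx 0) e e0).
  by have [f0 _ _] := fP n; rewrite metric_sym -{1}f0.
split => //; last by move=> s e s0; exact: rP.
  move=> s t /= s0 t0; apply/eqP; rewrite eq_le; apply/andP; split.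
    apply/ler_addgt0Pl => e e0; have e20 : 0 < e / 2 by rewrite divr_gt0.
    have h : 0 <= Num.max s t by rewrite le_max s0.
    have [n [[[fg _] n1] n2]] :=
      filter_ex (filterI (filterI (fs _ h) (rP s s0 _ e20)) (rP t t0 _ e20)).
    have := fg s t; rewrite /= !in_itv/= s0 t0 !le_max !lexx orbT => /(_ isT isT) <-.
    have := metric_triangle (r s) (f n s) (r t).
    have := metric_triangle (f n s) (f n t) (r t).
    by rewrite (metric_sym (r s) (f n s)); lra.
  apply/ler_addgt0Pl => e e0; have e20 : 0 < e / 2 by rewrite divr_gt0.
  have h : 0 <= Num.max s t by rewrite le_max s0.
  have [n [[[fg _] n1] n2]] :=
      filter_ex (filterI (filterI (fs _ h) (rP s s0 _ e20)) (rP t t0 _ e20)).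
  have := fg s t; rewrite /= !in_itv/= s0 t0 !le_max !lexx orbT => /(_ isT isT) <-.
  have := metric_triangle (f n s) (r s) (f n t).
  have := metric_triangle (r s) (r t) (f n t).
  by rewrite (metric_sym (r t) (f n t)); lra.
exists (2 * K + 1) => t t0.
have [n [[_ n1] n2]] := filter_ex (filterI (fs t t0) (rP t t0 1 ltr01)).
by have := metric_triangle (c t) (f n t) (r t); lra.
Unshelve. all: by end_near.
Qed.

End Rays.

(** * Length metrics and the sphere *)

Section LengthMetric.
Variables (R : realType) (T : Type) (d : T -> T -> \bar R).

Lemma length_metric_ge x y : (d x y <= length_metric d x y)%E.
Proof.
apply: le_ereal_inf_tmp => _ [g [_ g0 g1] <-].
apply: ereal_sup_ubound; exists [:: 1]; last by rewrite /= big_nat1 g0 g1.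
exact: itv_partition1.
Qed.

Lemma length_metric_le_lipschitz (g : R -> T) (L : R) : 0 <= L ->
  (forall s t, 0 <= s <= 1 -> 0 <= t <= 1 -> d (g s) (g t) = (`|s - t| * L)%:E) ->
  (length_metric d (g 0%R) (g 1%R) <= L%:E)%E.
Proof.
move=> L0 gL; apply: ge_ereal_inf; exists (curve_length d g).
  exists g => //; split=> // t t01 e e0; exists (e / (L + 1)).
    by rewrite divr_gt0//; lra.
  move=> s s01; rewrite gL// lte_fin ltr_pdivlMr//; last by lra.
  by apply: le_lt_trans; rewrite ler_wpM2l//; lra.
apply: ge_ereal_sup => _ [s sp <-].
suff H a : 0 <= a -> itv_partition a 1 s ->
   (\sum_(0 <= n < size s) d (g (nth 1%R (a :: s) n)) (g (nth 1%R (a :: s) n.+1))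
    <= ((1 - a) * L)%:E)%E.
  by have := H 0 (lexx _) sp; rewrite subr0 mul1r.
elim: s a {sp} => [|x s IH] a a0 asp.
  by rewrite big_geq// (itv_partition_nil asp) subrr mul0r.
have ax : a < x by case: asp => /= /andP[].
have xs := itv_partition_cons asp.
have x1 : x <= 1 := itv_partition_le xs.
have x0 : 0 <= x by rewrite (le_trans a0)// ltW.
rewrite /= big_nat_recl//= gL ?a0 ?x0 ?x1 ?(le_trans (ltW ax))//.
have -> : ((1 - a) * L)%:E = (`|a - x| * L)%:E + ((1 - x) * L)%:E :> \bar R.
  rewrite -EFinD distrC gtr0_norm ?subr_gt0//; congr _%:E; ring.
by rewrite leeD2l//; exact: IH.
Qed.

End LengthMetric.

Section Sphere.
Variable R : realType.

Lemma cos_ge_sub (a b h : R) : 0 <= a <= pi -> 0 <= b <= pi -> 0 <= h ->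
  a <= b + h -> cos b - h <= cos a.
Proof.
move=> a0 b0 h0 abh; have [ab|ba] := leP a b.
  have : cos b <= cos a.
    by rewrite leNgt ltr_cos ?in_itv//= -leNgt.
  by lra.
have [|c _] := @MVT_segment R cos (fun x => - sin x) b a (ltW ba)
  (fun x _ => is_derive_cos x).
  by apply: continuous_subspaceT => x; exact: continuous_cos.
have := sin_le1 c; nra.
Qed.

Variable n : nat.
Implicit Types u v : sphere R n.

Definition sdot u v : R := dotv (sval u) (sval v).

Lemma sdot_itv u v : -1 <= sdot u v <= 1.
Proof. exact: dotv_unit_itv (svalP u) (svalP v). Qed.

Lemma sphere_inj u v : sval u = sval v -> u = v.
Proof.
case: u v => [u hu] [v hv] /= uv; rewrite uv in hu *.
by congr exist; exact: Prop_irrelevance.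
Qed.

(** The arc of great circle from [u] to [v] has the right length. Antipodal
    points are excluded because they are at infinite distance in the sphere of
    dimension [0]. *)
Lemma sphere_dist_le u v : sdot u v != -1 ->
  (sphere_dist u v <= (acos (sdot u v))%:E)%E.
Proof.
move=> uv1; have uvI := sdot_itv u v.
pose d (x y : sphere R n) := (acos (dotv (sval x) (sval y)))%:E.
rewrite /sphere_dist -/d.
have [uv|uv] := eqVneq (sdot u v) 1.
  have -> : v = u by apply/esym/sphere_inj/dotv_unit_eq1; rewrite ?(svalP u) ?(svalP v).
  have -> : sdot u u = 1 by rewrite /sdot (svalP u).
  rewrite acos1.
  apply: (@length_metric_le_lipschitz _ _ _ (fun=> u) 0) => // s t _ _.
  by rewrite /d (svalP u) acos1 mulr0.
set a := acos (sdot u v).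
have ca : cos a = sdot u v by rewrite acosK.
have a0 : 0 <= a by exact: acos_ge0.
have api : a <= pi by exact: acos_lepi.
have sa : 0 < sin a.
  apply: sin_gt0_pi; rewrite acos_gt0 ?acos_ltpi//; move: uvI => /andP[h1 h2].
    by rewrite h2 andbT lt_neqAle eq_sym uv1.
  by rewrite h1 lt_neqAle uv.
pose w := (sin a)^-1 *: (sval v - cos a *: sval u).
have uu : dotv (sval u) (sval u) = 1 := svalP u.
have vv : dotv (sval v) (sval v) = 1 := svalP v.
have uw : dotv (sval u) w = 0.
  by rewrite /w !dotvE uu -/(sdot u v) -ca mulr1 subrr mulr0.
have ww : dotv w w = 1.
  rewrite /w !dotvE uu vv (dotvC (sval v) (sval u)) -/(sdot u v) -ca.
  have := cos2Dsin2 a; move: (sin a) (cos a) sa => x y x0 e.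
  have yx : 1 - y ^+ 2 = x ^+ 2 by rewrite -e; ring.
  transitivity (x^-1 ^+ 2 * (1 - y ^+ 2)); first by ring.
  by rewrite yx; field; rewrite gt_eqF.
have wE : sin a *: w = sval v - cos a *: sval u.
  by rewrite /w scalerA divff ?gt_eqF// scale1r.
clearbody w.
have gdot s t : dotv (cos s *: sval u + sin s *: w) (cos t *: sval u + sin t *: w)
    = cos (s - t).
  by rewrite cosB !dotvE uu ww (dotvC w) uw; ring.
have g1 t : dotv (cos t *: sval u + sin t *: w) (cos t *: sval u + sin t *: w) = 1.
  by rewrite gdot subrr cos0.
pose g t : sphere R n := exist _ _ (g1 (t * a)).
have -> : u = g 0.
  by apply: sphere_inj; rewrite /= mul0r cos0 sin0 scale1r scale0r addr0.
have -> : v = g 1.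
  by apply: sphere_inj; rewrite /= mul1r wE addrC subrK.
refine (@length_metric_le_lipschitz R _ d g a a0 _). move=> s t /andP[s0 s1] /andP[t0 t1].
rewrite /d /= gdot -mulrBl; congr _%:E.
have h : cos ((s - t) * a) = cos (`|s - t| * a).
  have [st|st] := leP 0 (s - t); first by rewrite ger0_norm.
  by rewrite ltr0_norm// mulNr cosN.
rewrite h cosK// in_itv/= mulr_ge0//=; apply: le_trans api.
by rewrite -[leRHS]mul1r ler_wpM2r// ler_norml; apply/andP; split; lra.
Qed.

End Sphere.

(** * Boundary points and unit vectors *)

(** Points of the two spaces correspond when they are at distance less than
    [delta] in some common ambient space. *)
Lemma GH_correspondence (R : realType) (T1 T2 : Type) (d1 : T1 -> T1 -> \bar R)
    (d2 : T2 -> T2 -> \bar R) (delta : R) :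
  (GH_dist d1 d2 < delta%:E)%E ->
  exists C : T1 -> T2 -> Prop,
    [/\ forall x, exists u, C x u, forall u, exists x, C x u &
        forall x y u v, C x u -> C y v ->
          (d1 x y <= d2 u v + (2 * delta)%:E)%E].
Proof.
move=> /ereal_inf_lt[h [Z [dZ [f1 [f2 [[_ _ dC dT] i1 i2 ->]]]]]].
move=> /ereal_inf_lt[_ [r [_ r1 r2] <-]]; rewrite lte_fin => rd.
exists (fun x u => (dZ (f1 x) (f2 u) < delta%:E)%E); split.
- move=> x; have [_ [u _ <-] ux] := r1 (f1 x) (ex_intro2 _ _ x I erefl).
  by exists u; rewrite dC (lt_trans ux)// lte_fin.
- move=> u; have [_ [x _ <-] xu] := r2 (f2 u) (ex_intro2 _ _ u I erefl).
  by exists x; rewrite (lt_trans xu)// lte_fin.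
- move=> x y u v xu yv; rewrite -i1 -i2.
  apply: (le_trans (dT _ (f2 u) _)).
  have -> : (2 * delta)%:E = (delta%:E + delta%:E)%E.
    by rewrite -EFinD; congr _%:E; ring.
  rewrite addeA addeC; apply: leeD; first exact: ltW.
  apply: (le_trans (dT _ (f2 v) _)); rewrite leeD2l// dC; exact: ltW.
Qed.

Section Boundary.
Variables (R : realType) (X : metricType R).
Implicit Types (p q x y : X) (c g : R -> X) (xi eta zeta : ideal_boundary X).

Lemma asymptotic_refl c : asymptotic c c.
Proof. by exists 0 => t _; rewrite mdistxx. Qed.

Lemma asymptotic_trans c1 c2 c3 :
  asymptotic c1 c2 -> asymptotic c2 c3 -> asymptotic c1 c3.
Proof.
move=> [K1 h1] [K2 h2]; exists (K1 + K2) => t t0.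
by rewrite (le_trans (metric_triangle _ (c2 t) _))// lerD ?h1 ?h2.
Qed.

Lemma boundary_ray xi c : sval xi c -> geodesic_ray c.
Proof. by case: xi => /= E [c0 _ ->] []. Qed.

Lemma boundary_rayP xi : exists c, sval xi c.
Proof.
by case: xi => /= E [c0 h ->]; exists c0; split=> //; exact: asymptotic_refl.
Qed.

Lemma boundary_asymptotic xi c c' :
  sval xi c -> geodesic_ray c' -> asymptotic c c' -> sval xi c'.
Proof.
case: xi => /= E [c0 _ ->] [_ c0c] cr' cc'; split=> //.
exact: asymptotic_trans cc'.
Qed.

Lemma boundary_of_ray c : geodesic_ray c -> exists xi, sval xi c.
Proof.
move=> cr; pose E := [set c' | geodesic_ray c' /\ asymptotic c c'].
have EP : exists2 c, geodesic_ray c &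
    E = [set c' | geodesic_ray c' /\ asymptotic c c'] by exists c.
exists (exist _ E EP); split => //; exact: asymptotic_refl.
Qed.

Lemma cos_comparison_angle p x y : 0 < mdist p x -> 0 < mdist p y ->
  [/\ 0 <= comparison_angle p x y, comparison_angle p x y <= pi &
      mdist p x * mdist p y * cos (comparison_angle p x y) = cprod p x y].
Proof.
move=> x0 y0; rewrite /comparison_angle.
have -> : (mdist p x ^+ 2 + mdist p y ^+ 2 - mdist x y ^+ 2) /
   (2 * mdist p x * mdist p y) = cprod p x y / (mdist p x * mdist p y).
  by rewrite /cprod; field; rewrite !gt_eqF.
have xy0 : 0 < mdist p x * mdist p y by rewrite mulr_gt0.
have h : -1 <= cprod p x y / (mdist p x * mdist p y) <= 1.
  have := cprod_norm p x y; rewrite ler_norml => h.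
  by rewrite ler_pdivlMr// ler_pdivrMr// mulN1r mul1r.
split; [exact: acos_ge0|exact: acos_lepi|].
by rewrite acosK// mulrC divfK// gt_eqF.
Qed.

Lemma geodesic_angle_near c c' (th k s0 t0 : R) :
  (geodesic_angle c c' <= th%:E)%E -> 0 < k -> 0 < s0 -> 0 < t0 ->
  exists s t, [/\ 0 < s <= s0, 0 < t <= t0 &
    comparison_angle (c 0) (c s) (c' t) < th + k].
Proof.
move=> h k0 s00 t00.
have : (geodesic_angle c c' < (th + k)%:E)%E.
  by rewrite (le_lt_trans h)// lte_fin ltrDl.
move=> /ereal_inf_lt[_ [V [[A B] /= [FA FB] AB] <-] hV].
have [s [[As s1] s2]] : exists s, (A s /\ 0 < s) /\ s <= s0.
  apply: (@filter_ex _ (0^'+)); apply: filterI; last exact: nbhs_right_le.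
  by apply: filterI => //; exact: nbhs_right_gt.
have [t [[Bt t1] t2]] : exists t, (B t /\ 0 < t) /\ t <= t0.
  apply: (@filter_ex _ (0^'+)); apply: filterI; last exact: nbhs_right_le.
  by apply: filterI => //; exact: nbhs_right_gt.
exists s, t; rewrite s1 s2 t1 t2; split=> //.
rewrite -lte_fin; apply: le_lt_trans hV; apply: ereal_sup_ubound.
by exists (s, t) => //; apply: AB.
Qed.

Hypotheses (X0 : CAT0 X) (Xp : proper_space X) (Xc : geodesically_complete X).

Lemma ray_from_to_exists p xi : exists c, ray_from_to p xi c.
Proof.
have [c cxi] := boundary_rayP xi.
have [_ [r [_ rr r0 cr _]]] := ray_from_point X0 Xp p (boundary_ray cxi).
by exists r; split=> //; exact: boundary_asymptotic cr.
Qed.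

Variables (n : nat) (C : ideal_boundary X -> sphere R n -> Prop) (delta : R).
Hypotheses (d0 : 0 < delta) (Cl : forall xi, exists u, C xi u)
  (Cd : forall xi eta u v, C xi u -> C eta v ->
     (Tits_dist xi eta <= sphere_dist u v + (2 * delta)%:E)%E).

(** The angle at [p] is at most the Tits distance, hence at most the spherical
    distance up to [2 * delta], and it is an upper limit of
    comparison angles. *)
Lemma cprod_ge p xi zeta u z c c' (k s0 t0 : R) :
  C xi u -> C zeta z -> ray_from_to p xi c -> ray_from_to p zeta c' ->
  0 < k -> 0 < s0 -> 0 < t0 ->
  exists s t, [/\ 0 < s <= s0, 0 < t <= t0 &
    s * t * (sdot u z - 2 * delta - k) <= cprod p (c s) (c' t)].
Proof.
move=> Cxi Czeta cxi czeta k0 s00 t00.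
have [c0 /boundary_ray cr] := cxi; have [c'0 /boundary_ray cr'] := czeta.
have dc s : 0 <= s -> mdist p (c s) = s by rewrite -c0; exact: ray_dist0.
have dc' s : 0 <= s -> mdist p (c' s) = s by rewrite -c'0; exact: ray_dist0.
(* The distance from [u] to [z] may be infinite here, but no angle exceeds [pi]. *)
have [uz|uz] := eqVneq (sdot u z) (-1).
  exists s0, t0; rewrite s00 t00 !lexx uz; split=> //.
  have := cprod_norm p (c s0) (c' t0).
  rewrite (dc _ (ltW s00)) (dc' _ (ltW t00)) ler_norml => /andP[+ _].
  apply: le_trans; have : 0 < s0 * t0 by rewrite mulr_gt0.
  by move: d0; nra.
have h : (geodesic_angle c c' <= (acos (sdot u z) + 2 * delta)%:E)%E.
  have h1 : (geodesic_angle c c' <= boundary_angle xi zeta)%E.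
    by apply: ereal_sup_ubound; exists p, c, c'.
  apply: (le_trans h1).
  apply: (le_trans (length_metric_ge (@boundary_angle R X) xi zeta)).
  apply: (le_trans (Cd Cxi Czeta)); rewrite EFinD leeD2r//.
  exact: sphere_dist_le.
have [s [t [/andP[s1 s2] /andP[t1 t2] hst]]] := geodesic_angle_near h k0 s00 t00.
exists s, t; rewrite s1 s2 t1 t2; split=> //; rewrite c0 in hst.
have := @cos_comparison_angle p (c s) (c' t).
rewrite (dc _ (ltW s1)) (dc' _ (ltW t1)) => /(_ s1 t1)[a0 api <-].
rewrite ler_pM2l ?mulr_gt0//.
have uzI := sdot_itv u z.
have ai : 0 <= comparison_angle p (c s) (c' t) <= pi by rewrite a0.
have bi : 0 <= acos (sdot u z) <= pi by rewrite acos_ge0 ?acos_lepi.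
have hk : 0 <= 2 * delta + k by move: d0; lra.
have hle : comparison_angle p (c s) (c' t) <= acos (sdot u z) + (2 * delta + k).
  by rewrite addrA ltW.
have := cos_ge_sub ai bi hk hle; rewrite acosK//; lra.
Qed.

(** Two rays forming a line near [p] make the angle [pi], so that by the
    previous lemma the angle between the corresponding unit vectors is almost
    [pi]. Collinearity up to distance [1] suffices: an extension of a ray is
    only known to agree with it on a bounded interval. *)
Lemma antipodal_sum p xi om u w c c' :
  C xi u -> C om w -> ray_from_to p xi c -> ray_from_to p om c' ->
  (forall s t, 0 < s <= 1 -> 0 < t <= 1 -> mdist (c s) (c' t) = s + t) ->
  dotv (sval u + sval w) (sval u + sval w) <= 4 * delta.
Proof.
move=> Cxi Com cxi com cc'.
apply/ler_addgt0Pl => e e0; have k0 : 0 < e / 2 by rewrite divr_gt0.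
have [s [t [sI tI]]] := cprod_ge Cxi Com cxi com k0 ltr01 ltr01.
have [c0 /boundary_ray cr] := cxi; have [c'0 /boundary_ray cr'] := com.
have /andP[s1 s2] := sI; have /andP[t1 t2] := tI.
rewrite /cprod cc'//.
have -> : mdist p (c s) = s by rewrite -c0 ray_dist0 ?ltW.
have -> : mdist p (c' t) = t by rewrite -c'0 ray_dist0 ?ltW.
have -> : (s ^+ 2 + t ^+ 2 - (s + t) ^+ 2) / 2 = s * t * -1 by field.
rewrite ler_pM2l ?mulr_gt0// => h.
have uu : dotv (sval u) (sval u) = 1 := svalP u.
have ww : dotv (sval w) (sval w) = 1 := svalP w.
rewrite !dotvE uu ww (dotvC (sval w)) -/(sdot u w); lra.
Qed.

Lemma sdot_antipodal (u w z : sphere R n) (e : R) : 0 <= e ->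
  dotv (sval u + sval w) (sval u + sval w) <= e ^+ 2 ->
  `|sdot w z + sdot u z| <= e.
Proof.
move=> e0 h; rewrite -ler_sqr ?nnegrE// real_normK ?num_real//.
have := dotv_sqr_le (sval u + sval w) (sval z).
have -> : dotv (sval z) (sval z) = 1 := svalP z.
rewrite mulr1 dotvDl addrC -/(sdot u z) -/(sdot w z) => h2.
by rewrite addrC (le_trans _ h)// addrC.
Qed.

(** Extend [c] beyond [p]. The extension leads to a boundary point whose unit
    vector is almost [- u] by the previous lemma, so its angle with [c'] is
    bounded above by [cprod_ge]; the two directions of the line make angles of
    sum at least [pi] with [c'], hence the angle of [c] and [c'] is bounded
    below. The number [e] bounds the distance of [- u] to the vector of the
    extension. *)
Lemma cprod_le p xi zeta u z c c' (k s0 t0 e : R) :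
  C xi u -> C zeta z -> ray_from_to p xi c -> ray_from_to p zeta c' ->
  0 < k -> 0 < s0 -> 0 < t0 -> 0 <= e -> 4 * delta <= e ^+ 2 ->
  exists s t, [/\ 0 < s <= s0, 0 < t <= t0 &
    cprod p (c s) (c' t) <= s * t * (sdot u z + 2 * delta + e + k)].
Proof.
move=> Cxi Czeta cxi czeta k0 s00 t00 e0 de.
have [c0 /boundary_ray cr] := cxi.
have [g gT gc] := line_extension X0 Xc ler01 (geodesic_rayS (T := 1) cr).
have g0 : g 0 = p by rewrite gc ?c0// lexx ler01.
have gr : geodesic_ray (fun t => g (- t)).
  by move=> s t _ _; rewrite gT// opprK addrC distrC.
have [om gom] := boundary_of_ray gr; have [w Com] := Cl om.
have rom : ray_from_to p om (fun t => g (- t)) by split=> //; rewrite oppr0.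
have uw : dotv (sval u + sval w) (sval u + sval w) <= e ^+ 2.
  apply: le_trans de; apply: (antipodal_sum Cxi Com cxi rom).
  move=> s t /andP[s1 s2] /andP[t1 t2].
  have s01 : 0 <= s <= 1 by rewrite s2 ltW.
  by rewrite -(gc s s01) gT// opprK gtr0_norm// addr_gt0.
have s10 : 0 < Num.min s0 1 by rewrite lt_min s00 ltr01.
have [s [t [/andP[s1 s2] tI h]]] := cprod_ge Com Czeta rom czeta k0 s10 t00.
move: s2; rewrite le_min => /andP[s2 s3].
exists s, t; rewrite s1 s2; split=> //.
have := cprod_opposite X0 (c' t) gT (ltW s1); rewrite g0 gc ?s3 ?(ltW s1)// => h2.
have st : 0 < s * t by rewrite mulr_gt0//; case/andP: tI.
have := sdot_antipodal z e0 uw; rewrite ler_norml => /andP[h3 _].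
nra.
Qed.

End Boundary.

(** * Busemann functions *)

Section Busemann.
Variables (R : realType) (X : metricType R).
Implicit Types (p q x y : X) (c g r : R -> X) (xi eta zeta : ideal_boundary X).

(** The infimum is the limit at infinity, by [busemann_mono]. *)
Definition busemann c x : R := inf [set mdist x (c s) - s | s in [set s | 0 <= s]].

Lemma busemann_le c x s : geodesic_ray c -> 0 <= s ->
  busemann c x <= mdist x (c s) - s.
Proof.
move=> cr s0; apply: ge_inf; last by exists s.
exists (- mdist x (c 0)) => _ [t t0 <-].
by have /andP[+ _] := ray_dist_bounds x cr t0; lra.
Qed.

Lemma busemann_ge c x (m : R) :
  (forall s, 0 <= s -> m <= mdist x (c s) - s) -> m <= busemann c x.
Proof.
move=> h; apply: lb_le_inf; first by exists (mdist x (c 0) - 0), 0 => /=.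
by move=> _ [s s0 <-]; exact: h.
Qed.

Lemma busemann_mono c x (s t : R) : geodesic_ray c -> 0 <= s -> s <= t ->
  mdist x (c t) - t <= mdist x (c s) - s.
Proof.
move=> cr s0 st; have := metric_triangle x (c s) (c t).
rewrite (cr s t)//=; last exact: le_trans st.
by rewrite distrC ger0_norm ?subr_ge0//; lra.
Qed.

Hypotheses (X0 : CAT0 X) (Xp : proper_space X) (Xc : geodesically_complete X).

(** First variation: if the ray from [p] to [xi] makes with [c'] a comparison
    angle of cosine at most [k], then so do the segments from [p] to far points
    of [c], whose distance to [c' t] is thus at least [mdist p (c s) - t * k]
    up to a small error. *)
Lemma busemann_slope_ge p xi c c' (t k : R) :
  sval xi c -> geodesic_on `[0, t] c' -> c' 0 = p -> 0 <= t ->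
  (forall r h, ray_from_to p xi r -> 0 < h -> 0 < t ->
     exists s u, [/\ 0 < s, 0 < u <= t &
       cprod p (r s) (c' u) <= s * u * (k + h)]) ->
  busemann c p - t * k <= busemann c (c' t).
Proof.
move=> cxi c'g c'0; rewrite le_eqVlt => /predU1P[<- _|t0 H].
  by rewrite mul0r subr0 c'0.
have cr := boundary_ray cxi.
suff h0 h : 0 < h -> busemann c p - t * (k + 3 * h) <= busemann c (c' t).
  apply/ler_addgt0Pl => e e0.
  have := h0 (e / (3 * t)); rewrite divr_gt0 ?mulr_gt0// => /(_ isT).
  have -> : t * (k + 3 * (e / (3 * t))) = t * k + e by field; rewrite gt_eqF.
  by lra.
move=> h0; have [f [r [fP rr r0 cr' fr]]] := ray_from_point X0 Xp p cr.
have rxi : ray_from_to p xi r by split=> //; exact: boundary_asymptotic cr'.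
have [s [u [s0 /andP[u0 ut] hsu]]] := H r h rxi h0 t0.
apply: busemann_ge => s' s'0.
set l := k + 3 * h.
pose K := mdist p (c 0).
have K0 : 0 <= K := mdist_ge0 _ _.
have su : 0 < s * u by rewrite mulr_gt0.
(* Moving [r s] by [e] changes the comparison product by at most [s * u * h]. *)
pose e := s * u * h / (s + u).
have e0 : 0 < e by rewrite divr_gt0 ?addr_gt0 ?mulr_gt0.
have [n [n1 [n2 [n3 n4]]]] : exists n : nat, mdist (f n s) (r s) <= e /\
   (s' < n%:R /\ (s + K < n%:R /\ K + t * l ^+ 2 / (2 * h) < n%:R)).
  apply: (@filter_ex _ \oo); apply: filterI; first exact: fr (ltW s0) e0.
  by apply: filterI; [|apply: filterI]; exact: nbhs_infty_gtr.
have nn0 : 0 <= n%:R :> R by exact: ler0n.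
have {n4} n4 : t * l ^+ 2 / (2 * h) < n%:R - K by lra.
apply: le_trans (busemann_mono (c' t) cr s'0 (ltW n2)).
have bp := busemann_le p cr nn0.
have [f0 f1 fg] := fP n.
have /andP[D1 _] := ray_dist_bounds p cr nn0.
rewrite -/K in D1; set D := mdist p (c n%:R) in D1 bp f1 fg.
suff : D - t * l <= mdist (c' t) (c n%:R) by lra.
have D0 : 0 < D by lra.
have sD : 0 <= s <= D by rewrite ltW//=; lra.
have uI : 0 <= u <= t by rewrite ut ltW.
have ff : f n 0 = c' 0 by rewrite f0 c'0.
have := cprod_mono X0 fg c'g ff D0 t0 sD uI; rewrite f1 f0 => hm.
have df : mdist p (f n s) = s by rewrite -f0 (geodesic_dist0 fg).
have dr : mdist p (r s) = s by rewrite -r0 (ray_dist0 rr)// ltW.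
have du : mdist p (c' u) = u by rewrite -c'0 (geodesic_dist0 c'g).
have dt : mdist p (c' t) = t by rewrite -c'0 (geodesic_dist0 c'g)// lexx ltW.
have hfs : cprod p (f n s) (c' u) <= s * u * (k + 2 * h).
  have := metric_triangle (r s) (f n s) (c' u).
  have := metric_triangle (f n s) (r s) (c' u).
  have := metric_triangle (r s) p (c' u).
  have := metric_triangle (f n s) p (c' u).
  have := mdist_ge0 (r s) (c' u); have := mdist_ge0 (f n s) (c' u).
  rewrite (metric_sym (r s) p) (metric_sym (f n s) p) (metric_sym (r s) (f n s)).
  move: hsu n1; rewrite /cprod df dr du.
  have ee : e * (s + u) = s * u * h by rewrite /e divfK// gt_eqF// addr_gt0.
  move: (mdist (r s) (c' u)) (mdist (f n s) (c' u)) (mdist (f n s) (r s)).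
  move=> a b d h1 h2 b0 a0 h3 h4 h5 h6.
  have h7 : a ^+ 2 - b ^+ 2 <= 2 * (s * u * h).
    rewrite -ee (_ : a ^+ 2 - b ^+ 2 = (a - b) * (a + b)); last by ring.
    have [ab|ab] := leP a b.
      apply: (@le_trans _ _ 0); last by rewrite ee !mulr_ge0// ltW.
      by rewrite mulr_le0_ge0 ?addr_ge0// subr_le0.
    rewrite (_ : 2 * (e * (s + u)) = e * (2 * (s + u))); last by ring.
    by apply: ler_pM; lra.
  by lra.
have {}hm : cprod p (c n%:R) (c' t) <= D * t * (k + 2 * h).
  rewrite -(ler_pM2l su); apply: (le_trans hm).
  rewrite (_ : s * u * (D * t * (k + 2 * h)) =
      D * t * (s * u * (k + 2 * h))); last by ring.
  by rewrite ler_pM2l ?mulr_gt0.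
have [Dl|Dl] := leP (D - t * l) 0; first exact: le_trans (mdist_ge0 _ _).
rewrite -ler_sqr ?nnegrE ?mdist_ge0 ?(ltW Dl)//.
move: hm; rewrite /cprod -/D dt (metric_sym (c n%:R)) => hm.
(* The far point is so far that the quadratic term of [(D - t * l) ^+ 2] is
   absorbed by the spare [h] in [l]. *)
have hl : t * l ^+ 2 <= D * (2 * h).
  by rewrite -ler_pdivrMr ?mulr_gt0//; lra.
have {}hl : t * (t * l ^+ 2) <= t * (D * (2 * h)) by rewrite ler_pM2l.
have kl : k + 2 * h = l - h by rewrite /l; ring.
rewrite kl in hm; have := sqr_ge0 t; move: hm hl; clear; move: (mdist _ _) => d.
by move=> *; lra.
Qed.

Variables (n : nat) (C : ideal_boundary X -> sphere R n -> Prop) (delta : R).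
Hypotheses (d0 : 0 < delta) (Cl : forall xi, exists u, C xi u)
  (Cd : forall xi eta u v, C xi u -> C eta v ->
     (Tits_dist xi eta <= sphere_dist u v + (2 * delta)%:E)%E).

(** Busemann functions are almost affine along rays: both inequalities are
    instances of the first variation, from the origin of the segment along the
    ray and from its end along a backward extension of it. *)
Lemma busemann_slope p xi zeta u z c c' (t e : R) :
  C xi u -> C zeta z -> sval xi c -> ray_from_to p zeta c' ->
  0 <= t -> 0 <= e -> 4 * delta <= e ^+ 2 ->
  `|busemann c (c' t) - busemann c p + t * sdot u z| <= t * (2 * delta + 2 * e).
Proof.
move=> Cxi Czeta cxi czeta t0 e0 de.
have [c'0 c'z] := czeta; have cr' := boundary_ray c'z.
have lo : busemann c p - t * (sdot u z + 2 * delta + e) <= busemann c (c' t).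
  apply: (busemann_slope_ge cxi (geodesic_rayS cr') c'0 t0) => r h rxi h0 t1.
  have [s [v [/andP[s0 _] vI hsv]]] :=
    cprod_le X0 Xc d0 Cl Cd Cxi Czeta rxi czeta h0 ltr01 t1 e0 de.
  by exists s, v.
have t10 : 0 <= t + 1 by lra.
(* The margin [1] makes the extension collinear with [c'] near [c' t] too. *)
have [g gT gc] := line_extension X0 Xc t10 (geodesic_rayS (T := t + 1) cr').
pose g' := fun s => g (t - s).
have gr' : geodesic_ray g'.
  by move=> s s' _ _; rewrite gT// distrC; congr `|_|; ring.
have [om g'om] := boundary_of_ray gr'; have [w Com] := Cl om.
have g'0 : g' 0 = c' t by rewrite /g' subr0 gc// t0; lra.
have g't : g' t = p by rewrite /g' subrr gc ?c'0// lexx.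
have rom : ray_from_to (c' t) om g' by split.
have rz : ray_from_to (c' t) zeta (fun s => c' (t + s)).
  split; first by rewrite addr0.
  apply: boundary_asymptotic c'z _ _.
    move=> s s' /= s0 s'0; rewrite cr'/= ?addr_ge0//; congr `|_|; ring.
  exists t => s s0; rewrite cr'/= ?addr_ge0//.
  by rewrite opprD addrCA subrr addr0 normrN ger0_norm.
have zw : dotv (sval z + sval w) (sval z + sval w) <= e ^+ 2.
  apply: le_trans de; apply: (antipodal_sum d0 Cd Czeta Com rz rom).
  move=> s s' /andP[s0 s1] /andP[s'0 s'1].
  rewrite -gc; last by apply/andP; split; lra.
  by rewrite gT// (_ : _ - _ = s + s') ?gtr0_norm ?addr_gt0//; ring.
have hi : busemann c (c' t) - t * (sdot u w + 2 * delta + e) <= busemann c p.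
  rewrite -g't.
  apply: (busemann_slope_ge cxi (geodesic_rayS gr') g'0 t0) => r h rxi h0 t1.
  have [s [v [/andP[s0 _] vI hsv]]] :=
    cprod_le X0 Xc d0 Cl Cd Cxi Com rxi rom h0 ltr01 t1 e0 de.
  by exists s, v.
have sC (a b : sphere R n) : sdot a b = sdot b a by exact: dotvC.
have := sdot_antipodal u e0 zw; rewrite (sC w) (sC z) ler_norml => /andP[h1 h2].
rewrite ler_norml; apply/andP; split; nra.
Qed.

End Busemann.

(** * Bi-Lipschitz maps onto Euclidean space *)

Section Bilipschitz.
Variables (R : realType) (X : metricType R) (n : nat) (F : X -> 'rV[R]_n) (a : R).
Hypotheses (a0 : 0 < a)
  (Fbl : bilipschitz (@mdist R X) (@eucl_dist R n) a F).

Lemma bilipschitz_continuous : continuous F.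
Proof.
move=> x; apply/cvg_ballP => e e0.
have h : 0 < e / a by rewrite divr_gt0.
near=> y; split=> // i j; rewrite (ord1 i); apply: le_lt_trans (eucl_dist_coord _ _ j) _.
have [Fle _] := Fbl x y; apply: (le_lt_trans Fle).
rewrite mulrC -ltr_pdivlMr//.
have : ball x (e / a) y by near: y; exact: nbhsx_ballx.
by rewrite ballEmdist.
Unshelve. all: by end_near.
Qed.

Lemma bilipschitz_surj_homeomorphism :
  (forall y, exists x, F x = y) -> homeomorphism F.
Proof.
move=> /choice[G FG]; split; first exact: bilipschitz_continuous.
exists G; split => //; last first.
  move=> x; apply: mdist_le_eps_eq => e e0; have [_] := Fbl (G (F x)) x.
  have -> : eucl_dist (F (G (F x))) (F x) = 0.
    by rewrite FG /eucl_dist subrr -(scale0r 0) dotvZl mul0r sqrtr0.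
  rewrite mulr0 => /le_trans.
  by apply; exact: ltW.
move=> y A /nbhs_ballP[e e0 eA].
pose b := a * (Num.sqrt n%:R + 1).
have b0 : 0 < b by rewrite mulr_gt0// ltr_wpDl ?sqrtr_ge0.
have h : 0 < e / b by rewrite divr_gt0.
apply/nbhs_ballP; exists (e / b) => //= z yz; apply: eA; rewrite ballEmdist/=.
have [_ Gle] := Fbl (G y) (G z); rewrite !FG in Gle.
apply: (le_lt_trans Gle).
have /(eucl_dist_le (ltW h)) hle i : `|y ord0 i - z ord0 i| <= e / b.
  by have [_ yzi] := yz; exact: ltW (yzi ord0 i).
apply: (@le_lt_trans _ _ (a * (e / b * Num.sqrt n%:R))); first by rewrite ler_pM2l.
rewrite (_ : a * (e / b * _) = e * (a * Num.sqrt n%:R / b)); last by ring.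
by rewrite -[ltRHS]mulr1 ltr_pM2l// ltr_pdivrMr// mul1r /b mulrDr mulr1 ltrDl.
Qed.

(** If every direction at every point of the image can be followed up to an
    error of ratio less than [1], then a point of the image closest to a point
    outside of it could be improved. *)
Lemma bilipschitz_surj (o : X) (rho : R) : proper_space X -> rho < 1 ->
  (forall p w t, dotv w w = 1 -> 0 <= t ->
     exists q, eucl_dist (F q) (F p + t *: w) <= t * rho) ->
  forall y, exists x, F x = y.
Proof.
move=> Xp r1 H y; pose h x := eucl_dist (F x) y.
have hlip x x' : h x <= h x' + a * mdist x x'.
  have [h1 _] := Fbl x x'; have := eucl_distD (F x) (F x') y.
  by rewrite /h; lra.
have hc : continuous h.
  move=> x; apply/cvgrPdist_lt => e e0.
  have ea : 0 < e / a by rewrite divr_gt0.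
  near=> x'; have : ball x (e / a) x' by near: x'; exact: nbhsx_ballx.
  rewrite ballEmdist/= ltr_pdivlMr// mulrC => hd.
  have := hlip x x'; have := hlip x' x; rewrite (metric_sym x' x) => h1 h2.
  by rewrite ltr_norml; apply/andP; split; lra.
pose A := [set x | h x <= h o].
have Ac : compact A.
  apply: Xp.
    have -> : A = h @^-1` [set r | r <= h o] by [].
    by apply: preimage_closed => //; exact: closed_le.
  exists o, (a * (h o + h o) + 1) => x; rewrite /A/= ballEmdist/= => ho.
  have [_] := Fbl o x; have := eucl_distD (F o) y (F x).
  rewrite (eucl_distC y (F x)) -/(h o) -/(h x) => h1 h2.
  apply: (@le_lt_trans _ _ (a * (h o + h o))); last by lra.
  by apply: (le_trans h2); rewrite ler_pM2l//; lra.
have [||x xA xmin] := @compact_EVT_min _ _ h A _ Ac.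
- by exists o; rewrite /A/=.
- exact: continuous_subspaceT.
have xmin' x' : h x <= h x'.
  have [h1|h1] := leP (h x') (h o); first by apply: xmin; rewrite inE.
  by move: xA; rewrite inE /A/= => h2; rewrite (le_trans h2)// ltW.
exists x; apply/subr0_eq/dotv_eq0; rewrite -eucl_dist_sqr -/(h x).
have [->|hx] := eqVneq (h x) 0; first by rewrite expr0n.
have hx0 : 0 < h x by rewrite lt_neqAle eq_sym hx eucl_dist_ge0.
have [|q] := H x ((h x)^-1 *: (y - F x)) (h x) _ (ltW hx0).
  rewrite dotvZl dotvZr -eucl_dist_sqr eucl_distC -/(h x) expr2.
  by rewrite mulrA mulrACA mulVf ?mul1r ?mulVf.
rewrite scalerA divff// scale1r addrC subrK -/(h q) => hq.
have := xmin' q; have : h x * rho < h x by rewrite gtr_pMr.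
by lra.
Unshelve. all: by end_near.
Qed.

End Bilipschitz.

(** * Rigidity *)

Theorem theorem5p12 (R : realType) (N : nat) (hN : (0 < N)%N)
    (eps : R) (heps : 0 < eps < 1) (n : nat) (hn : (0 < n)%N) :
  exists2 delta : R, 0 < delta &
    forall X : metricType R,
      doubling N X -> proper_space X -> geodesically_complete X -> CAT0 X ->
      (GH_dist (@Tits_dist R X) (@sphere_dist R n) < delta%:E)%E ->
      bilipschitz_homeomorphic_Rn (1 + eps) X n.
Proof.
have /andP[eps0 eps1] := heps.
(* By [busemann_slope] with [4 * delta = e ^+ 2], each coordinate of [F] below
   varies along a ray as expected up to the ratio [2 * delta + 2 * e <= 3 * e];
   [e] is chosen so that the Euclidean error has ratio at most [eps / 2], which
   is enough since [(1 + eps) * (1 - eps / 2) >= 1]. *)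
pose M : R := Num.sqrt n%:R.
have M0 : 0 <= M by exact: sqrtr_ge0.
pose e := eps / (6 * (M + 1)).
have M1 : 0 < 6 * (M + 1) by lra.
have e0 : 0 < e by rewrite divr_gt0.
have eM : e * (6 * (M + 1)) = eps by rewrite /e divfK// gt_eqF.
pose delta := e ^+ 2 / 4.
have delta0 : 0 < delta by rewrite divr_gt0// exprn_gt0.
have de : 4 * delta <= e ^+ 2 by rewrite /delta mulrC divfK// gt_eqF.
pose rho := (2 * delta + 2 * e) * M.
have e1 : e <= 1 by nra.
have de2 : 2 * delta + 2 * e <= 3 * e by rewrite /delta; nra.
have rho0 : 0 <= rho by rewrite /rho mulr_ge0//; lra.
have rhoe : rho <= eps / 2.
  apply: (@le_trans _ _ (3 * e * M)); first by rewrite /rho ler_wpM2r.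
  by rewrite -eM; nra.
exists delta => // X _ Xp Xc X0 /GH_correspondence[C [Cl Cr Cd]].
have /choice[xi xiP] : forall i : 'I_n, exists x, exists2 u : sphere R n,
    sval u = delta_mx 0 i & C x u.
  move=> i; have d1 : dotv (delta_mx 0 i : 'rV[R]_n) (delta_mx 0 i) = 1.
    rewrite /dotv (bigD1 i)//= !mxE !eqxx mulr1 big1 ?addr0// => j ji.
    by rewrite !mxE (negbTE ji) andbF mulr0.
  have [x Cx] := Cr (exist _ _ d1).
  by exists x, (exist (fun u : 'rV[R]_n => dotv u u = 1) _ d1).
have /choice[c cP] : forall i, exists c, sval (xi i) c by move=> i; exact: boundary_rayP.
(* The sign makes [F] move towards [z] along a ray with unit vector [z]. *)
pose F x : 'rV[R]_n := \row_i (- busemann (c i) x).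
have key p zeta z c' t : C zeta z -> ray_from_to p zeta c' -> 0 <= t ->
    eucl_dist (F (c' t)) (F p + t *: sval z) <= t * rho.
  move=> Cz cz t0; rewrite /rho mulrA; apply: eucl_dist_le.
    by rewrite mulr_ge0//; lra.
  move=> i; have [u ui Cu] := xiP i; rewrite !mxE.
  have := busemann_slope X0 Xp Xc delta0 Cl Cd Cu Cz (cP i) cz t0 (ltW e0) de.
  have -> : sdot u z = sval z ord0 i.
    rewrite /sdot /dotv ui (bigD1 i)//= mxE !eqxx mul1r big1 ?addr0// => j ji.
    by rewrite mxE (negbTE ji) andbF mul0r.
  by rewrite -normrN; congr (`|_| <= _); ring.
have shift (v w : 'rV[R]_n) t : dotv w w = 1 -> 0 <= t -> eucl_dist (v + t *: w) v = t.
  move=> w1 t0; rewrite /eucl_dist addrC addKr dotvZl dotvZr w1 mulr1.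
  by rewrite -expr2 sqrtr_sqr ger0_norm.
have Fd p q : (1 - rho) * mdist p q <= eucl_dist (F p) (F q) <= (1 + rho) * mdist p q.
  have [Xg _] := X0; have [f [f0 f1 fg]] := Xg p q.
  have t0 := mdist_ge0 p q.
  have [g gT gf] := line_extension X0 Xc t0 fg.
  have gr : geodesic_ray g by move=> s t _ _; exact: gT.
  have [zeta gz] := boundary_of_ray gr; have [z Cz] := Cl zeta.
  have g0 : g 0 = p by rewrite gf// lexx.
  have g1 : g (mdist p q) = q by rewrite gf// t0 lexx.
  have := key p zeta z g _ Cz (conj g0 gz) t0; rewrite g1.
  have := shift (F p) (sval z) _ (svalP z) t0.
  move: (F p + _) => v vt hv.
  have := eucl_distD (F p) (F q) v; have := eucl_distD (F p) v (F q).
  rewrite (eucl_distC (F p) v) (eucl_distC v (F q)) vt.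
  by move=> *; apply/andP; split; lra.
have Fbl : bilipschitz (@mdist R X) (@eucl_dist R n) (1 + eps) F.
  move=> x y; have /andP[h1 h2] := Fd x y; have d0 := mdist_ge0 x y.
  split; first by apply: (le_trans h2); rewrite ler_wpM2r//; lra.
  have h3 : (1 + eps) * ((1 - rho) * mdist x y) <= (1 + eps) * eucl_dist (F x) (F y).
    by rewrite ler_pM2l//; lra.
  apply: le_trans h3; rewrite mulrA -[leLHS]mul1r ler_wpM2r//; nra.
have a0 : 0 < 1 + eps by lra.
exists F => //; apply: (bilipschitz_surj_homeomorphism a0 Fbl).
pose i0 := Ordinal hn.
apply: (bilipschitz_surj a0 Fbl (c i0 0) (rho := rho) Xp); first by lra.
move=> p w t w1 t0; have [zeta Cz] := Cr (exist _ w w1).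
have [c' cz] := ray_from_to_exists X0 Xp p zeta.
by exists (c' t); exact: key Cz cz t0.
Qed.
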